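(* Fix a parameter $x$, multipliers $\mu\in\mathbb{R}^p_{\ge0}$, $\lambda\in\mathbb{R}^q$ and a penalty parameter $\rho>0$. Let $\mathcal{Y}\subseteq\mathbb{R}^n$ be compact and assume: (1) the feasible region $Y(x)=\{y\in\mathcal{Y}: g(x,y)\le 0,\ h(x,y)=0\}$ is non-empty and compact; (2) $f(x,\cdot)$, $g(x,\cdot)=(g_1,\dots,g_p)$ and $h(x,\cdot)=(h_1,\dots,h_q)$ are continuously differentiable in $y$ on $\mathcal{Y}$; (3) at every $y\in Y(x)$ a constraint qualification (the Mangasarian-Fromovitz or the linear independence constraint qualification) holds. Then for every $\epsilon>0$ there exist input convex neural network (ICNN) parameters $\theta$ such that, if $y_k=\arg\min_{y\in\mathcal{Y}}f_\theta(y)$, where $f_\theta$ is the function computed by the ICNN, then $$L_\rho(y_k;x,\mu,\lambda)\le\min_{y\in\mathcal{Y}}L_\rho(y;x,\mu,\lambda)+\epsilon.$$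
   Context: Write $\operatorname{ReLU}(z)=\max\{z,0\}$ (componentwise on vectors). The augmented Lagrangian is $$L_\rho(y;x,\mu,\lambda)=f(x,y)+\mu^T\operatorname{ReLU}(g(x,y))+\lambda^T h(x,y)+\frac{\rho}{2}\Big(\sum_{j=1}^p \operatorname{ReLU}(g_j(x,y))^2+\sum_{i=1}^q h_i(x,y)^2\Big).$$ An ICNN (of arbitrary depth $K$ and arbitrary layer widths) is a feed-forward network with $z_{i+1}=a_i(W^{(z)}_i z_i+W^{(y)}_i y+b_i)$ for $i=0,\dots,K-1$ (with $W^{(z)}_0=0$) and scalar output $f_\theta(y)=z_K$. The activations $a_i$ are convex and non-decreasing (ReLU on hidden layers, and ReLU or the identity on the output layer), the weights $W^{(z)}_i$ are entrywise non-negative, and the passthrough weights $W^{(y)}_i$ and biases $b_i$ are arbitrary. The parameters are $\theta=\{W^{(y)}_{0:K-1},W^{(z)}_{1:K-1},b_{0:K-1}\}$. The function $f_\theta$ is convex in $y$. The notation $y_k=\arg\min_{y\in\mathcal{Y}}f_\theta(y)$ means that $y_k$ is a minimizer of $f_\theta$ over $\mathcal{Y}$. *)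

(* Defs.v *)
From HB Require Import structures.
From mathcomp Require Import all_boot all_order all_algebra.
From mathcomp Require Import all_classical all_reals all_analysis.

Set Implicit Arguments.
Unset Strict Implicit.
Unset Printing Implicit Defensive.

Import Order.TTheory GRing.Theory Num.Theory.
Import numFieldNormedType.Exports.

Local Open Scope classical_set_scope.
Local Open Scope ring_scope.

(* Vectors are row vectors, as for the library's Jacobian 'J: linear maps act
   by right multiplication, and the gradient of the j-th component of F is the
   j-th column of 'J F y.                                                     *)

Definition relu (R : realType) (z : R) : R := Num.max z 0.

Definition relu_vec (R : realType) (m : nat) (z : 'rV[R]_m) : 'rV[R]_m :=
  map_mx (@relu R) z.

Definition is_argmin (T : Type) (R : realType) (Y : set T) (F : T -> R)
    (y : T) : Prop :=
  Y y /\ forall y', Y y' -> F y <= F y'.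

Section Problem.
Variables (R : realType) (n p q : nat) (X : Type).
Variables (f : X -> 'rV[R]_n -> R) (g : X -> 'rV[R]_n -> 'rV[R]_p)
  (h : X -> 'rV[R]_n -> 'rV[R]_q).

Definition aug_lagrangian (rho : R) (x : X) (mu : 'rV[R]_p) (lambda : 'rV[R]_q)
    (y : 'rV[R]_n) : R :=
  f x y + \sum_(j < p) mu 0 j * relu_vec (g x y) 0 j
  + \sum_(i < q) lambda 0 i * h x y 0 i
  + rho / 2 * (\sum_(j < p) relu (g x y 0 j) ^+ 2
               + \sum_(i < q) h x y 0 i ^+ 2).

Definition feasible (Y : set 'rV[R]_n) (x : X) : set 'rV[R]_n :=
  [set y | [/\ Y y, forall j, g x y 0 j <= 0 & h x y = 0]].

Definition grad (m : nat) (F : 'rV[R]_n -> 'rV[R]_m) (y : 'rV[R]_n)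
    (j : 'I_m) : 'rV[R]_n := row j ('J F y)^T.

(* [free] is linear independence of a family: a repeated vector breaks it. *)
Definition MFCQ (x : X) (y : 'rV[R]_n) : Prop :=
  free [seq grad (h x) y i | i <- enum 'I_q] /\
  exists d : 'rV[R]_n,
    (forall i, (d *m (grad (h x) y i)^T) 0 0 = 0) /\
    (forall j, g x y 0 j = 0 -> (d *m (grad (g x) y j)^T) 0 0 < 0).

Definition LICQ (x : X) (y : 'rV[R]_n) : Prop :=
  free ([seq grad (g x) y j | j <- enum 'I_p & g x y 0 j == 0] ++
        [seq grad (h x) y i | i <- enum 'I_q]).

End Problem.

(* The domain is finite-dimensional, so continuity of y |-> 'd F y v on Y for
   each v amounts to continuity of y |-> 'd F y in operator norm.  No condition
   is imposed outside Y, so this is implied by F being C^1 on an open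
   neighbourhood of Y.                                                        *)
Definition continuously_differentiable_on (R : realType) (n : nat)
    (W : normedModType R) (Y : set 'rV[R]_n) (F : 'rV[R]_n -> W) : Prop :=
  (forall y, Y y -> differentiable F y) /\
  (forall v, {within Y, continuous (fun y => 'd F y v)}).

(* [icnn_layers R n m] describes layers 0, ..., i of a network with input in
   R^n and z_{i+1} in R^m. The number of layers and all the widths are free.
   The first layer has no z-weight, which encodes W^(z)_0 = 0.                *)
Inductive icnn_layers (R : realType) (n : nat) : nat -> Type :=
| FirstLayer (m : nat) (Wy : 'M[R]_(n, m)) (b : 'rV[R]_m) : icnn_layers R n m
| NextLayer (m m' : nat) (prev : icnn_layers R n m)
    (Wz : 'M[R]_(m, m')) (Wz_ge0 : forall i j, 0 <= Wz i j)
    (Wy : 'M[R]_(n, m')) (b : 'rV[R]_m') : icnn_layers R n m'.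

(* Value of the last layer before its activation; every earlier layer, being
   hidden, is activated by ReLU.                                              *)
Fixpoint preactivation (R : realType) (n m : nat) (l : icnn_layers R n m)
    (y : 'rV[R]_n) : 'rV[R]_m :=
  match l with
  | FirstLayer _ Wy b => y *m Wy + b
  | NextLayer _ _ prev Wz _ Wy b =>
      relu_vec (preactivation prev y) *m Wz + y *m Wy + b
  end.

Inductive output_activation := OutReLU | OutId.

Definition apply_activation (R : realType) (a : output_activation) (z : R) : R :=
  match a with OutReLU => relu z | OutId => z end.

Record icnn (R : realType) (n : nat) := ICNN {
  icnn_body : icnn_layers R n 1;
  icnn_out : output_activation
}.

Definition icnn_fun (R : realType) (n : nat) (theta : icnn R n)
    (y : 'rV[R]_n) : R :=
  apply_activation (icnn_out theta) (preactivation (icnn_body theta) y 0 0).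

(* Main.v *)
Require Import Defs.
From HB Require Import structures.
From mathcomp Require Import all_boot all_order all_algebra.
From mathcomp Require Import all_classical all_reals all_analysis.
Import Order.TTheory GRing.Theory Num.Theory.
Import numFieldNormedType.Exports.

Local Open Scope classical_set_scope.
Local Open Scope ring_scope.

(** An ICNN need not resemble the augmented Lagrangian [L] to have its minimizer
in the right place. By compactness [L], which is continuous at every point of
[Y], has a minimizer [ystar] on [Y] ([aug_lagrangian_has_argmin]). The convex
function [y |-> \sum_i `|y_i - ystar_i|] is an ICNN with one hidden layer of
width [2n], because [`|t| = relu t + relu (- t)] ([icnn_fun_l1_dist]), and its
only minimizer on [Y] is [ystar] ([argmin_l1_dist]). The minimizers of this one
network thus minimize [L] exactly, so the same parameters serve every
[eps]. *)

Section Continuity.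
Variables (R : realType) (T : topologicalType).

Lemma continuous_at_sum (I : Type) (r : seq I) (F : I -> T -> R) (y : T) :
  (forall i, {for y, continuous (F i)}) ->
  {for y, continuous (fun z => \sum_(i <- r) F i z)}.
Proof.
move=> Fc; elim: r => [|i r IHr]; rewrite /prop_for.
  under eq_fun do rewrite big_nil.
  exact: cst_continuous.
under eq_fun do rewrite big_cons.
exact: continuousD (Fc i) IHr.
Qed.

Lemma continuous_at_relu (F : T -> R) (y : T) :
  {for y, continuous F} -> {for y, continuous (fun z => relu (F z))}.
Proof.
by move=> Fc; apply: continuous_max; [exact: Fc|exact: cst_continuous].
Qed.

Lemma continuous_at_sqr (F : T -> R) (y : T) :
  {for y, continuous F} -> {for y, continuous (fun z => F z ^+ 2)}.
Proof. by move=> Fc; exact: (@continuousM R T F F y). Qed.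

Lemma continuous_at_scale (c : R) (F : T -> R) (y : T) :
  {for y, continuous F} -> {for y, continuous (fun z => c * F z)}.
Proof. by move=> Fc; apply: continuousM; [exact: cst_continuous|exact: Fc]. Qed.

Lemma continuous_at_coord (m : nat) (F : T -> 'rV[R]_m) (j : 'I_m) (y : T) :
  {for y, continuous F} -> {for y, continuous (fun z => F z 0 j)}.
Proof.
move=> Fc; apply: (@continuous_comp _ _ _ F (fun M : 'rV[R]_m => M 0 j)) => //.
exact: coord_continuous.
Qed.

End Continuity.

Section Minimizer.
Variables (R : realType) (n p q : nat) (X : Type).
Variables (f : X -> 'rV[R]_n -> R) (g : X -> 'rV[R]_n -> 'rV[R]_p)
  (h : X -> 'rV[R]_n -> 'rV[R]_q).
Variables (rho : R) (x : X) (mu : 'rV[R]_p) (lambda : 'rV[R]_q).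

Lemma continuous_at_aug_lagrangian (y : 'rV[R]_n) :
  {for y, continuous (f x)} -> {for y, continuous (g x)} ->
  {for y, continuous (h x)} ->
  {for y, continuous (aug_lagrangian f g h rho x mu lambda)}.
Proof.
move=> fc gc hc.
have gjc j : {for y, continuous (fun z => relu (g x z 0 j))}.
  by apply: continuous_at_relu; exact: continuous_at_coord gc.
have hic i : {for y, continuous (fun z => h x z 0 i)}.
  exact: continuous_at_coord hc.
apply: continuousD; first apply: continuousD; first apply: continuousD => //.
- apply: continuous_at_sum => j; apply: continuous_at_scale.
  rewrite /prop_for; under eq_fun do rewrite mxE.
  exact: gjc.
- by apply: continuous_at_sum => i; exact: continuous_at_scale.
- apply: continuous_at_scale; apply: continuousD;
    apply: continuous_at_sum => j; exact: continuous_at_sqr.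
Qed.

Lemma aug_lagrangian_has_argmin (Y : set 'rV[R]_n) :
  Y !=set0 -> compact Y ->
  (forall y, Y y -> {for y, continuous (f x)}) ->
  (forall y, Y y -> {for y, continuous (g x)}) ->
  (forall y, Y y -> {for y, continuous (h x)}) ->
  exists ystar, is_argmin Y (aug_lagrangian f g h rho x mu lambda) ystar.
Proof.
move=> Y0 Yc fc gc hc.
have Lc : {within Y, continuous (aug_lagrangian f g h rho x mu lambda)}.
  apply: continuous_in_subspaceT => y /set_mem Yy.
  exact: continuous_at_aug_lagrangian (fc y Yy) (gc y Yy) (hc y Yy).
have [ystar /set_mem Yystar ystar_min] := compact_EVT_min Y0 Yc Lc.
by exists ystar; split=> // y /mem_set; exact: ystar_min.
Qed.

End Minimizer.

Section L1Distance.
Variables (R : realType) (n : nat) (c : 'rV[R]_n).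

Definition l1_dist (y : 'rV[R]_n) : R := \sum_(i < n) `|y 0 i - c 0 i|.

Lemma relu_add_opp (t : R) : relu t + relu (- t) = `|t|.
Proof.
rewrite /relu; case: (lerP 0 t) => t0.
  by rewrite max_r ?addr0 ?ger0_norm // oppr_le0.
by rewrite add0r max_l ?ltr0_norm // oppr_ge0 ltW.
Qed.

Lemma const1_ge0 (m m' : nat) (i : 'I_m) (j : 'I_m') :
  0 <= (const_mx 1 : 'M[R]_(m, m')) i j.
Proof. by rewrite mxE ler01. Qed.

(** The hidden layer holds the positive and the negative parts of [y - c]. The
signs sit in the unconstrained passthrough weights, so the [Wz] weights of the
output layer, which must be nonnegative, can all be 1. *)
Definition l1_icnn : icnn R n :=
  ICNN
    (NextLayer (FirstLayer (row_mx 1%:M (- 1%:M)) (row_mx (- c) c))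
       (@const1_ge0 (n + n) 1) 0 0)
    OutId.

Lemma icnn_fun_l1_dist (y : 'rV[R]_n) : icnn_fun l1_icnn y = l1_dist y.
Proof.
rewrite /icnn_fun /= mulmx0 !addr0 mul_mx_row mulmxN mulmx1 add_row_mx /relu_vec map_row_mx.
rewrite mxE big_split_ord /= -big_split /=; apply: eq_bigr => i _.
rewrite row_mxEl row_mxEr !mxE !mulr1 -relu_add_opp.
by rewrite opprB [- _ + _]addrC.
Qed.

Lemma l1_dist_eq0 (y : 'rV[R]_n) : l1_dist y = 0 -> y = c.
Proof.
move=> /psumr_eq0P yc; apply/rowP => i.
by apply/eqP; rewrite -subr_eq0 -normr_eq0 yc.
Qed.

Lemma argmin_l1_dist (Y : set 'rV[R]_n) (y : 'rV[R]_n) :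
  Y c -> is_argmin Y l1_dist y -> y = c.
Proof.
move=> Yc [_ /(_ c Yc) y_le]; apply: l1_dist_eq0; apply: le_anti.
rewrite sumr_ge0 // andbT (le_trans y_le) // /l1_dist big1 // => i _.
by rewrite subrr normr0.
Qed.

End L1Distance.

Theorem theoremA5 (R : realType) (n p q : nat) (X : Type)
    (f : X -> 'rV[R]_n -> R)
    (g : X -> 'rV[R]_n -> 'rV[R]_p)
    (h : X -> 'rV[R]_n -> 'rV[R]_q)
    (x : X) (mu : 'rV[R]_p) (lambda : 'rV[R]_q) (rho : R)
    (mu_ge0 : forall j, 0 <= mu 0 j) (rho_gt0 : 0 < rho)
    (Y : set 'rV[R]_n) (Y_compact : compact Y)
    (feasible_nonempty : feasible g h Y x !=set0)
    (feasible_compact : compact (feasible g h Y x))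
    (f_C1 : continuously_differentiable_on Y (f x))
    (g_C1 : continuously_differentiable_on Y (g x))
    (h_C1 : continuously_differentiable_on Y (h x))
    (CQ : forall y, feasible g h Y x y -> MFCQ g h x y \/ LICQ g h x y) :
  exists ystar : 'rV[R]_n,
    is_argmin Y (aug_lagrangian f g h rho x mu lambda) ystar /\
    forall eps : R, 0 < eps ->
      exists theta : icnn R n,
        forall yk : 'rV[R]_n, is_argmin Y (icnn_fun theta) yk ->
          aug_lagrangian f g h rho x mu lambda yk
          <= aug_lagrangian f g h rho x mu lambda ystar + eps.
Proof.
have diff_cont (W : normedModType R) (F : 'rV[R]_n -> W) :
    continuously_differentiable_on Y F ->
    forall y, Y y -> {for y, continuous F}.
  by move=> [dF _] y Yy; exact: differentiable_continuous (dF y Yy).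
have [ystar ystar_min] : exists ystar,
    is_argmin Y (aug_lagrangian f g h rho x mu lambda) ystar.
  apply: aug_lagrangian_has_argmin => //; try exact: diff_cont.
  by case: feasible_nonempty => y [Yy _ _]; exists y.
exists ystar; split=> // eps eps_gt0; exists (l1_icnn R n ystar) => yk.
rewrite (funext (icnn_fun_l1_dist R n ystar)).
move=> /(argmin_l1_dist _ _ _ _ _ ystar_min.1) ->.
by rewrite lerDl ltW.
Qed.
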